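(* Let $(\mathcal{D},\mathcal{A},C,\mathbb{V})$ be a (zero-sum) QIF-game over a finite secret set $\mathcal{X}$ and finite output set $\mathcal{Y}$, with prior $\pi\in\mathbb{D}\mathcal{X}$. Then the game has a Nash equilibrium, which in general is given by mixed strategies: there exists a mixed strategy profile $(\delta^*,\alpha^* )\in\mathbb{D}\mathcal{D}\times\mathbb{D}\mathcal{A}$ such that for all $\delta\in\mathbb{D}\mathcal{D}$ and all $\alpha\in\mathbb{D}\mathcal{A}$, $$\mathbb{V}(\delta^*,\alpha)\le \mathbb{V}(\delta^*,\alpha^* )\le \mathbb{V}(\delta,\alpha^* ).$$
   Context: For a finite set $\mathcal{I}$, $\mathbb{D}\mathcal{I}$ denotes the set of all probability distributions on $\mathcal{I}$. A channel $C:\mathcal{X}\times\mathcal{Y}\to\mathbb{R}$ (with $\mathcal{X},\mathcal{Y}$ finite) satisfies $0\le C(x,y)\le 1$ and $\sum_{y}C(x,y)=1$ for every $x$. A vulnerability measure is a continuous convex function $\mathbb{V}:\mathbb{D}\mathcal{X}\to\mathbb{R}$. For a prior $\pi\in\mathbb{D}\mathcal{X}$ and a channel $C$, let $p(x,y)=\pi(x)C(x,y)$, $p(y)=\sum_x p(x,y)$ and, if $p(y)\neq 0$, $p_{X\mid y}(x)=p(x,y)/p(y)$. The posterior vulnerability is $\mathbb{V}[\pi,C]=\sum_{y:\,p(y)>0}p(y)\,\mathbb{V}(p_{X\mid y})$. A QIF-game $(\mathcal{D},\mathcal{A},C,\mathbb{V})$ consists of nonempty finite sets $\mathcal{D}$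 (the defender's actions) and $\mathcal{A}$ (the attacker's actions), a family $C=\{C_{da}\}_{d\in\mathcal{D},a\in\mathcal{A}}$ of channels all of the same type $\mathcal{X}\times\mathcal{Y}\to\mathbb{R}$, and a vulnerability measure $\mathbb{V}$. Mixed strategies are $\delta\in\mathbb{D}\mathcal{D}$ for the defender and $\alpha\in\mathbb{D}\mathcal{A}$ for the attacker. The attacker's utility is $$\mathbb{V}(\delta,\alpha)=\sum_{a}\alpha(a)\,\mathbb{V}\Bigl[\pi,\sum_{d}\delta(d)C_{da}\Bigr],$$ where the sum of channels is entrywise. The game is zero-sum: the defender's utility is $-\mathbb{V}(\delta,\alpha)$, so the attacker maximizes and the defender minimizes $\mathbb{V}(\delta,\alpha)$. *)

(* Defs.v *)
From HB Require Import structures.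
From mathcomp Require Import all_boot all_order all_algebra.
From mathcomp Require Import all_classical all_reals all_analysis.

Set Implicit Arguments.
Unset Strict Implicit.
Unset Printing Implicit Defensive.

Import Order.TTheory GRing.Theory Num.Theory.
Import numFieldNormedType.Exports.

Local Open Scope classical_set_scope.
Local Open Scope ring_scope.

Definition dist (R : realType) (I : finType) : set (I -> R) :=
  [set p | (forall i, 0 <= p i) /\ \sum_i p i = 1].
Arguments dist : clear implicits.

Definition channel (R : realType) (X Y : finType) : set (X -> Y -> R) :=
  [set C | (forall x y, 0 <= C x y <= 1) /\ (forall x, \sum_y C x y = 1)].
Arguments channel : clear implicits.

(* Functions on [dist R X] are represented by total functions on [X -> R]
   whose values outside [dist R X] are irrelevant.  The pointwise topology on
   [X -> R] is the Euclidean one, since [X] is finite. *)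
Definition vulnerability_measure (R : realType) (X : finType) :
    set ((X -> R) -> R) :=
  [set V | {within (dist R X : set {ptws X -> R}),
              continuous (V : {ptws X -> R} -> R)} /\
           @convex_function R (X -> R^o : lmodType R) (dist R X) V].
Arguments vulnerability_measure : clear implicits.

Section Posterior.
Context (R : realType) (X Y : finType).
Implicit Types (p : X -> R) (C : X -> Y -> R) (V : (X -> R) -> R).

Definition joint p C (x : X) (y : Y) : R := p x * C x y.

Definition output p C (y : Y) : R := \sum_x joint p C x y.

Definition posterior p C (y : Y) : X -> R :=
  fun x => joint p C x y / output p C y.

Definition posterior_vulnerability V p C : R :=
  \sum_(y | 0 < output p C y) output p C y * V (posterior p C y).

End Posterior.

Record qif_game (R : realType) (X Y D A : finType) := QIFGame {
  game_channel : D -> A -> X -> Y -> R;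
  game_measure : (X -> R) -> R;
  defender_nonempty : (0 < #|D|)%N;
  attacker_nonempty : (0 < #|A|)%N;
  game_channelP : forall d a, channel R X Y (game_channel d a);
  game_measureP : vulnerability_measure R X game_measure }.

Section Utility.
Context (R : realType) (X Y D A : finType) (G : qif_game R X Y D A).

(* The attacker observes the output but not the defender's action, so the
   channels are averaged over [d] before the posterior vulnerability is taken,
   while the average over [a] is taken outside. *)
Definition mixed_channel (delta : D -> R) (a : A) : X -> Y -> R :=
  fun x y => \sum_d delta d * game_channel G d a x y.

Definition utility (p : X -> R) (delta : D -> R) (alpha : A -> R) : R :=
  \sum_a alpha a *
    posterior_vulnerability (game_measure G) p (mixed_channel delta a).

End Utility.

(* Main.v *)
(* For each pure attack a, the utility u a is convex and continuous in the
   defender's mixed strategy delta: the posterior vulnerability is the sum over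
   the outputs of the perspective j |-> |j| V(j / |j|) of V at the joint
   probabilities, which are linear in delta.  Hence max_a u a attains its
   minimum v at some delta'.  The convex functions u a - v are nowhere all
   negative, so by the theorem of the alternative of Fan, Glicksberg and
   Hoffman some convex combination alpha' of them is nonnegative everywhere,
   and (delta', alpha') is a saddle point of value v. *)

Require Import Defs.
From HB Require Import structures.
From mathcomp Require Import all_boot all_order all_algebra.
From mathcomp Require Import all_classical all_reals all_analysis.
From mathcomp Require Import ring lra.

Import Order.TTheory GRing.Theory Num.Theory.
Import numFieldNormedType.Exports.

Local Open Scope classical_set_scope.
Local Open Scope ring_scope.

(** * Convex functions and the theorem of the alternative *)

Definition convex_on {R : realType} {E : lmodType R} (S : set E) (f : E -> R) :=
  forall (t : R) (x y : E), 0 <= t <= 1 -> S x -> S y ->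
    S (t *: x + (1 - t) *: y) /\
    f (t *: x + (1 - t) *: y) <= t * f x + (1 - t) * f y.

(** For weights 1 - t on [f] and t on [g], a point where [f] is negative imposes a lower bound on t
    and a point where [g] is negative an upper bound. Cleared of denominators, the inequality says
    that the lower bound does not exceed the upper one. *)
Lemma convex_on_cross {R : realType} {E : lmodType R} {S : set E}
    {f g : E -> R} {x y : E} :
  convex_on S f -> convex_on S g ->
  (forall z, S z -> 0 <= f z \/ 0 <= g z) ->
  S x -> S y -> f x < 0 -> g y < 0 -> f x * g y <= f y * g x.
Proof.
move=> cf cg fg Sx Sy fx gy.
have gx : 0 <= g x by case: (fg x Sx) => //; rewrite leNgt fx.
have fy : 0 <= f y by case: (fg y Sy) => //; rewrite [0 <= g y]leNgt gy.
rewrite leNgt; apply/negP => lt.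
(* At the point [t x + (1 - t) y] with [t = (f y - g y) / d], the chords of
   [f] and [g] take the same value, which would be negative. *)
set d := f y - g y + g x - f x.
have d0 : 0 < d by rewrite /d; lra.
set t := (f y - g y) / d.
have tE : t * d = f y - g y by rewrite /t divfK ?gt_eqF.
have t01 : 0 <= t <= 1.
  apply/andP; split; first by rewrite /t divr_ge0 //; lra.
  by rewrite /t ler_pdivrMr // /d; lra.
have [Sz fz] := cf t x y t01 Sx Sy.
have [_ gz] := cg t x y t01 Sx Sy.
have fE : (t * f x + (1 - t) * f y) * d = f y * g x - f x * g y.
  have -> : (t * f x + (1 - t) * f y) * d = (t * d) * (f x - f y) + f y * d.
    by ring.
  by rewrite tE /d; ring.
have gE : (t * g x + (1 - t) * g y) * d = f y * g x - f x * g y.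
  have -> : (t * g x + (1 - t) * g y) * d = (t * d) * (g x - g y) + g y * d.
    by ring.
  by rewrite tE /d; ring.
have neg a : a * d = f y * g x - f x * g y -> a < 0.
  by move=> aE; rewrite -(pmulr_llt0 _ d0) aE subr_lt0.
case: (fg _ Sz) => z0.
  by have := neg _ fE; rewrite ltNge (le_trans z0 fz).
by have := neg _ gE; rewrite ltNge (le_trans z0 gz).
Qed.

(** Every lower bound -f x / (g x - f x) on t lies below every upper bound f y / (f y - g y), so the
    supremum of the lower bounds meets both kinds of constraint. *)
Lemma convex_alternative2 {R : realType} {E : lmodType R} {S : set E}
    {f g : E -> R} :
  convex_on S f -> convex_on S g ->
  (forall z, S z -> 0 <= f z \/ 0 <= g z) ->
  exists2 t, 0 <= t <= 1 & forall z, S z -> 0 <= (1 - t) * f z + t * g z.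
Proof.
move=> cf cg fg.
(* Including 0 keeps [L] nonempty, and its supremum nonnegative, even when [f] is nowhere
   negative. *)
pose L := [set r | r = 0 \/ exists2 x, S x /\ f x < 0 & r = - f x / (g x - f x)].
have gx x : S x -> f x < 0 -> 0 <= g x.
  by move=> Sx fx; case: (fg x Sx) => //; rewrite leNgt fx.
have L0 : L 0 by left.
have L1 : ubound L 1.
  move=> _ [->|[x [Sx fx] ->]] //.
  have := gx x Sx fx => gx0.
  by rewrite ler_pdivrMr; lra.
have hL : has_sup L by split; [exists 0 | exists 1].
have s0 : 0 <= sup L by exact: (ub_le_sup hL.2 L0).
have s1 : sup L <= 1 by apply: ge_sup => //; exists 0.
exists (sup L); first by rewrite s0.
move=> y Sy; case: (ltrP (f y) 0) => [fy|fy].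
  have gy := gx y Sy fy.
  have : - f y / (g y - f y) <= sup L.
    by apply: (ub_le_sup hL.2); right; exists y.
  by rewrite ler_pdivrMr; last lra; move=> h; lra.
case: (ltrP (g y) 0) => [gy|gy]; last first.
  by rewrite addr_ge0 // mulr_ge0 // subr_ge0.
have : sup L <= f y / (f y - g y).
  apply: ge_sup; first by exists 0.
  move=> _ [->|[x [Sx fx] ->]]; first by rewrite divr_ge0 //; lra.
  have gx0 := gx x Sx fx.
  have := convex_on_cross cf cg fg Sx Sy fx gy => cr.
  rewrite ler_pdivrMr; last lra.
  rewrite mulrAC ler_pdivlMr; last lra.
  by lra.
by rewrite ler_pdivlMr; last lra; move=> h; lra.
Qed.

(** By induction on the list, the functions other than [f b] have a convex combination that is
    nonnegative wherever [f b] is negative. This combination and [f b] are then never both negative,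
    and the case of two functions merges them. *)
Lemma convex_alternative {R : realType} {E : lmodType R} {A : eqType}
    (s : seq A) (S : set E) (f : A -> E -> R) :
  uniq s -> S !=set0 -> (forall a, a \in s -> convex_on S (f a)) ->
  (forall x, S x -> exists2 a, a \in s & 0 <= f a x) ->
  exists w : A -> R, [/\ forall a, 0 <= w a, \sum_(a <- s) w a = 1 &
    forall x, S x -> 0 <= \sum_(a <- s) w a * f a x].
Proof.
elim: s S => [|b s IH] S.
  by move=> _ [x Sx] _ /(_ x Sx) [].
move=> /= /andP[bs us] S0 cf pos.
pose S' := S `&` [set x | f b x < 0].
have cb : convex_on S (f b) by apply: cf; rewrite mem_head.
have cs a : a \in s -> convex_on S (f a).
  by move=> h; apply: cf; rewrite inE h orbT.
have sumb (v : R) (w : A -> R) (F : A -> R) :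
    \sum_(a <- s) (if a == b then v else w a) * F a = \sum_(a <- s) w a * F a.
  apply: eq_big_seq => a as_; case: eqP => // ab.
  by move: bs; rewrite -ab as_.
(* The induction hypothesis needs a nonempty set; if [f b] is nowhere negative, the point mass at
   [b] suffices. *)
have [S'0|/set0P S'0] := eqVneq S' set0.
  exists (fun a => if a == b then 1 else 0); split.
  - by move=> a; case: ifP.
  - rewrite big_cons eqxx big_seq big1 ?addr0 // => a as_.
    by case: eqP => // ab; move: bs; rewrite -ab as_.
  - move=> x Sx; rewrite big_cons eqxx sumb mul1r big1 ?addr0; last first.
      by move=> *; rewrite mul0r.
    rewrite leNgt; apply/negP => fx.
    by have : S' x by []; rewrite S'0.
have cS' t x y : 0 <= t <= 1 -> S' x -> S' y -> S' (t *: x + (1 - t) *: y).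
  move=> t01 [Sx fx] [Sy fy]; have [Sz fz] := cb t x y t01 Sx Sy.
  split=> //=; apply: le_lt_trans fz _; rewrite /= in fx fy.
  (* At t = 0 the term in [f b x] vanishes and strictness comes from [f b y]; otherwise it comes
     from [f b x]. *)
  case/andP: t01; rewrite le_eqVlt => /predU1P[<- _|t0 t1].
    by rewrite mul0r add0r subr0 mul1r.
  rewrite -(addr0 0) ltr_leD // ?pmulr_rlt0 //.
  by rewrite mulr_ge0_le0 ?subr_ge0 // ltW.
(* On [S'], where [f b] is negative, the other functions are never all
   negative. *)
have [w [w0 w1 ws]] : exists w : A -> R, [/\ forall a, 0 <= w a,
    \sum_(a <- s) w a = 1 & forall x, S' x -> 0 <= \sum_(a <- s) w a * f a x].
  apply: IH => //.
    move=> a as_ t x y t01 S'x S'y; split; first exact: cS'.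
    by have [] := cs a as_ t x y t01 S'x.1 S'y.1.
  move=> x [Sx fx]; have [a] := pos x Sx.
  rewrite inE => /predU1P[->|as_ fa]; last by exists a.
  by rewrite leNgt fx.
pose g x := \sum_(a <- s) w a * f a x.
have cg : convex_on S g.
  rewrite /g => t x y t01 Sx Sy; have [Sz _] := cb t x y t01 Sx Sy; split=> //.
  rewrite !mulr_sumr -big_split /= big_seq [leRHS]big_seq.
  apply: ler_sum => a as_.
  have [_ /(ler_wpM2l (w0 a)) /le_trans] := cs a as_ t x y t01 Sx Sy.
  by apply; rewrite mulrDr !(mulrCA (w a)).
have [|t /andP[t0 t1] tfg] := convex_alternative2 cb cg.
  move=> x Sx; case: (lerP 0 (f b x)) => fx; first by left.
  by right; apply: ws.
exists (fun a => if a == b then 1 - t else t * w a); split.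
- by move=> a; case: ifP => _; rewrite ?mulr_ge0 ?subr_ge0.
- rewrite big_cons eqxx; under eq_bigr do rewrite -[if _ then _ else _]mulr1.
  rewrite sumb; under eq_bigr do rewrite mulr1.
  by rewrite -mulr_sumr w1 mulr1 subrK.
- move=> x Sx; rewrite big_cons eqxx sumb.
  under eq_bigr do rewrite -mulrA.
  by rewrite -mulr_sumr tfg.
Qed.

(** * Pointwise topology and compactness of the simplex *)

Lemma ptws_cvgP {T I : Type} {R : realType} (F : set_system T) (f : T -> I -> R)
    (l : I -> R) : Filter F ->
  (forall i, f t i @[t --> F] --> l i) ->
  f t @[t --> F] --> (l : {ptws I -> R}).
Proof.
(* The pointwise topology is the supremum of the topologies induced by the coordinates. *)
move=> FF fl; apply/cvg_sup => i U [V [[W oW <-] Wl WU]].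
apply: (filterS WU); apply: (fl i).
exact: open_nbhs_nbhs.
Qed.

Lemma ptws_cvg_coord {I : eqType} {R : realType} (l : {ptws I -> R}) (i : I) :
  (x i @[x --> l]) --> l i.
Proof. exact: (@proj_continuous I (fun=> R) i l). Qed.

Lemma cvg_sumr {T I : Type} {R : realType} (F : set_system T) (s : seq I)
    (P : pred I) (f : I -> T -> R) (l : I -> R) : Filter F ->
  (forall i, P i -> f i t @[t --> F] --> l i) ->
  \sum_(i <- s | P i) f i t @[t --> F] --> \sum_(i <- s | P i) l i.
Proof. by move=> FF; apply: cvg_big; exact: add_continuous. Qed.

Lemma dist_le1 {R : realType} {I : finType} {p : I -> R} (i : I) :
  dist R I p -> p i <= 1.
Proof.
by move=> [p0 <-]; rewrite (bigD1 i) //= lerDl sumr_ge0.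
Qed.

(** The simplex is the intersection of a cube, compact by Tychonoff, with a closed hyperplane. *)
Lemma compact_dist (R : realType) (I : finType) :
  compact (dist R I : set {ptws I -> R}).
Proof.
have -> : (dist R I : set {ptws I -> R}) =
    [set x | forall i, `[0, 1]%classic (x i)] `&` [set x | \sum_i x i = 1].
  apply/seteqP; split => x /=.
    move=> dx; split; last exact: dx.2.
    by move=> i; rewrite in_itv /= dx.1 (dist_le1 i dx).
  by move=> [x01 x1]; split=> // i; have := x01 i; rewrite in_itv => /andP[].
apply: compact_closedI.
  exact: (@tychonoff I (fun=> R) (fun=> `[0, 1]%classic)
    (fun=> @segment_compact R 0 1)).
have cs : continuous (fun x : {ptws I -> R} => \sum_i x i).
  move=> x.
  apply: (@cvg_sumr _ _ _ (nbhs x) _ _ (fun i (x : {ptws I -> R}) => x i)).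
  move=> i _.
  exact: (ptws_cvg_coord x i).
apply: (@closed_comp _ _ (fun x : {ptws I -> R} => \sum_i x i) [set 1]).
  by move=> x _; exact: cs.
exact: closed_eq.
Qed.

Lemma dist_convex {R : realType} {I : finType} {t : R} {x y : I -> R} :
  0 <= t <= 1 -> dist R I x -> dist R I y ->
  dist R I (fun i => t * x i + (1 - t) * y i).
Proof.
move=> /andP[t0 t1] [x0 x1] [y0 y1]; split.
  by move=> i; rewrite addr_ge0 // mulr_ge0 // subr_ge0.
by rewrite big_split /= -!mulr_sumr x1 y1; ring.
Qed.

Lemma dist_nonempty (R : realType) {I : finType} :
  (0 < #|I|)%N -> dist R I !=set0.
Proof.
move=> /card_gt0P[i _]; exists (fun j => (j == i)%:R); split.
  by move=> j; rewrite ler0n.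
by rewrite (bigD1 i) //= eqxx big1 ?addr0 // => j /negbTE ->.
Qed.

(** * Vulnerability measures and their perspectives *)

Lemma vulnerability_convex {R : realType} {X : finType} {V : (X -> R) -> R}
    {t : R} {x y : X -> R} :
  vulnerability_measure R X V -> 0 <= t <= 1 -> dist R X x -> dist R X y ->
  V (fun i => t * x i + (1 - t) * y i) <= t * V x + (1 - t) * V y.
Proof.
move=> [_ cV] t01 dx dy.
pose t' : {i01 R} := Itv01 (proj1 (andP t01)) (proj2 (andP t01)).
exact: (cV t' x y (mem_set dx) (mem_set dy)).
Qed.

Lemma vulnerability_bounded {R : realType} {X : finType} {V : (X -> R) -> R} :
  vulnerability_measure R X V ->
  exists2 M, 0 <= M & forall x, dist R X x -> `|V x| <= M.
Proof.
move=> [cV _].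
have := continuous_compact cV (compact_dist R X).
move=> /compact_bounded[M [Mr HM]].
(* Every number above [M] is a bound, hence M + 1 is; the maximum with 0 secures nonnegativity. *)
exists (Num.max 0 (M + 1)); first by rewrite le_max lexx.
move=> x dx; apply: le_trans (HM (M + 1) _ (V x) _) _.
- by rewrite ltrDl.
- by exists x.
- by rewrite le_max lexx orbT.
Qed.

(* Extended by 0 where the total mass vanishes, so that it is continuous and
   positively homogeneous on the whole nonnegative orthant. *)
Definition perspective {R : realType} {X : finType} (V : (X -> R) -> R)
    (j : X -> R) : R :=
  if 0 < \sum_x j x then (\sum_x j x) * V (fun x => j x / \sum_x j x) else 0.

Lemma dist_normalize {R : realType} {X : finType} {j : X -> R} :
  (forall x, 0 <= j x) -> 0 < \sum_x j x ->
  dist R X (fun x => j x / \sum_x j x).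
Proof.
move=> j0 s0; split; first by move=> x; rewrite divr_ge0 // ltW.
by rewrite -mulr_suml divff // gt_eqF.
Qed.

(** The total mass of the joint column at y is the output probability, and the restriction to
    positive probabilities becomes the default 0 of [perspective]. *)
Lemma posterior_vulnerabilityE {R : realType} {X Y : finType}
    (V : (X -> R) -> R) (p : X -> R) (C : X -> Y -> R) :
  posterior_vulnerability V p C = \sum_y perspective V (joint p C ^~ y).
Proof. by rewrite /posterior_vulnerability big_mkcond. Qed.

Lemma sumr_gt0_or_eq0 {R : realType} {X : finType} (j : X -> R) :
  (forall x, 0 <= j x) -> (0 < \sum_x j x) \/ (j = fun=> 0).
Proof.
move=> j0; have : 0 <= \sum_x j x by exact: sumr_ge0.
rewrite le_eqVlt => /predU1P[/esym/eqP|]; last by left.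
rewrite psumr_eq0 // => /allP h; right; apply/funext => x.
by apply/eqP/(implyP (h x _)) => //; rewrite mem_index_enum.
Qed.

Lemma perspective0 {R : realType} {X : finType} (V : (X -> R) -> R) :
  perspective V (fun=> 0) = 0.
Proof. by rewrite /perspective big1 // ltxx. Qed.

Lemma perspectiveZ {R : realType} {X : finType} (V : (X -> R) -> R) (t : R)
    (j : X -> R) :
  0 <= t -> perspective V (fun x => t * j x) = t * perspective V j.
Proof.
rewrite le_eqVlt => /predU1P[<-|t0].
  by under eq_fun do rewrite mul0r; rewrite perspective0 mul0r.
rewrite /perspective -mulr_sumr pmulr_rgt0 //.
case: ifPn => // s0; last by rewrite mulr0.
rewrite mulrA; congr (_ * V _); apply/funext => x.
by rewrite -mulf_div divff ?mul1r // gt_eqF.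
Qed.

(** The normalization of j + k is the mixture of those of j and k with weights proportional to their
    masses, so convexity of [V], multiplied by the total mass, gives subadditivity. Together with
    [perspectiveZ] this yields convexity on the nonnegative orthant. *)
Lemma perspectiveD {R : realType} {X : finType} {V : (X -> R) -> R}
    {j k : X -> R} : vulnerability_measure R X V ->
  (forall x, 0 <= j x) -> (forall x, 0 <= k x) ->
  perspective V (fun x => j x + k x) <= perspective V j + perspective V k.
Proof.
move=> hV j0 k0.
have [sj|->] := sumr_gt0_or_eq0 j j0; last first.
  by under eq_fun do rewrite add0r; rewrite perspective0 add0r.
have [sk|->] := sumr_gt0_or_eq0 k k0; last first.
  by under eq_fun do rewrite addr0; rewrite perspective0 addr0.
rewrite /perspective big_split /= addr_gt0 // sj sk.
set a := \sum_x j x in sj *; set b := \sum_x k x in sk *.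
have ab : 0 < a + b by exact: addr_gt0.
have t01 : 0 <= a / (a + b) <= 1.
  by rewrite divr_ge0 ?(ltW sj) ?(ltW ab) //= ler_pdivrMr // mul1r lerDl ltW.
have := vulnerability_convex hV t01 (dist_normalize j0 sj) (dist_normalize k0 sk).
rewrite -/a -/b.
have -> : (fun x => a / (a + b) * (j x / a) + (1 - a / (a + b)) * (k x / b)) =
    (fun x => (j x + k x) / (a + b)).
  by apply/funext => x; field; rewrite !gt_eqF.
rewrite -(ler_pM2l ab) => /le_trans; apply; rewrite le_eqVlt; apply/predU1P.
by left; field; rewrite gt_eqF.
Qed.

(** Where the limit has positive mass, normalization is continuous and so is [V] on the simplex. At
    the limit 0, where normalization breaks down, boundedness of [V] squeezes the perspective by a
    multiple of the mass. *)
Lemma cvg_perspective {T : Type} {R : realType} {X : finType}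
    {V : (X -> R) -> R} {F : set_system T} {j : T -> X -> R} {l : X -> R} :
  vulnerability_measure R X V -> Filter F ->
  (forall x, 0 <= l x) -> (\forall t \near F, forall x, 0 <= j t x) ->
  (forall x, j t x @[t --> F] --> l x) ->
  perspective V (j t) @[t --> F] --> perspective V l.
Proof.
move=> hV FF l0 j0 jl.
have sl : \sum_x j t x @[t --> F] --> \sum_x l x.
  by apply: (@cvg_sumr _ _ _ F _ _ (fun x t => j t x)).
have [s0|lE] := sumr_gt0_or_eq0 l l0; last first.
  rewrite lE perspective0.
  have [M M0 VM] := vulnerability_bounded hV.
  have s0 : \sum_x j t x @[t --> F] --> 0 by move: sl; rewrite lE big1.
  have Ms0 : M * \sum_x j t x @[t --> F] --> 0.
    by rewrite -[X in _ --> X](mulr0 M); apply: cvgM => //; exact: cvg_cst.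
  have bound : \forall t \near F, `|perspective V (j t)| <= M * \sum_x j t x.
    apply: filterS j0 => t jt; rewrite /perspective; case: ifPn => st.
      rewrite normrM gtr0_norm // mulrC ler_wpM2r ?(ltW st) //.
      exact/VM/dist_normalize.
    by rewrite normr0 mulr_ge0 // sumr_ge0.
  apply/norm_cvg0P; apply: (squeeze_cvgr _ (cvg_cst 0) Ms0).
  by apply: filterS bound => t ->; rewrite normr_ge0.
have s0F : \forall t \near F, 0 < \sum_x j t x by exact: (cvgr_gt _ sl).
have -> : perspective V l = (\sum_x l x) * V (fun x => l x / \sum_x l x).
  by rewrite /perspective s0.
apply: (@cvg_trans _
  ((\sum_x j t x) * V (fun x => j t x / \sum_x j t x) @[t --> F])).
  apply: near_eq_cvg; apply: filterS s0F => t st.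
  by rewrite /perspective st.
apply: cvgM => //.
have [/subspace_continuousP cV _] := hV.
have dl := dist_normalize l0 s0.
apply: (cvg_trans _ (cV _ dl)).
apply: (@cvg_comp _ _ _ (fun t x => j t x / \sum_x j t x) V F); last first.
  exact: cvg_id.
have cn : (fun x => j t x / \sum_x j t x) @[t --> F] -->
    ((fun x => l x / \sum_x l x) : {ptws X -> R}).
  apply: ptws_cvgP => x; apply: cvgM => //.
  by apply: cvgV => //; rewrite gt_eqF.
(* [V] is continuous only relative to the simplex, so the normalized points must also eventually lie
   in it. *)
move=> U /= /cn; rewrite /fmap /= => cnU; near=> t.
have : dist R X (fun x => j t x / \sum_x j t x).
  by apply: dist_normalize; near: t.
by near: t.
Unshelve. all: end_near. Qed.

(** * Saddle points for finitely many convex payoffs *)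

Lemma continuous_bigmaxr {R : realType} {T : topologicalType} {I : Type}
    (s : seq I) (f0 : T -> R) (f : I -> T -> R) :
  continuous f0 -> (forall i, continuous (f i)) ->
  continuous (fun x => \big[Order.max/f0 x]_(i <- s) f i x).
Proof.
move=> c0 cf; elim: s => [|i s IH].
  by under eq_fun do rewrite big_nil.
under eq_fun do rewrite big_cons.
by move=> x; apply: continuous_max; [exact: cf | exact: IH].
Qed.

Lemma convex_game_saddle_point {R : realType} {D A : finType}
    (u : A -> (D -> R) -> R) : (0 < #|D|)%N -> (0 < #|A|)%N ->
  (forall a, convex_on (dist R D : set (D -> R^o)) (u a)) ->
  (forall a, {within (dist R D : set {ptws D -> R}),
     continuous (u a : {ptws D -> R} -> R)}) ->
  exists delta' alpha', [/\ dist R D delta', dist R A alpha' &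
    forall delta alpha, dist R D delta -> dist R A alpha ->
      \sum_a alpha a * u a delta' <= \sum_a alpha' a * u a delta' /\
      \sum_a alpha' a * u a delta' <= \sum_a alpha' a * u a delta].
Proof.
move=> D0 /card_gt0P[a0 _] cu ctu.
(* The base value [u a0 x] is itself one of the payoffs, so this is exactly their maximum. *)
pose U (x : {ptws D -> R}) := \big[Order.max/u a0 x]_(a : A) u a x.
have cU : {within (dist R D : set {ptws D -> R}), continuous U}.
  by apply: continuous_bigmaxr => [|a]; exact: ctu.
have dD := dist_nonempty R D0.
have [z /set_mem dz zmin] :=
  @compact_EVT_min {ptws D -> R} R U _ dD (compact_dist R D) cU.
have uU a x : u a x <= U x by exact: le_bigmax.
have [|x dx|w [w0 w1 wz]] := @convex_alternative R (D -> R^o) A (index_enum A)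
    (dist R D) (fun a x => u a x - U z) (index_enum_uniq A) dD.
- move=> a _ t x y t01 dx dy; have [dt ut] := cu a t x y t01 dx dy.
  by split=> //; lra.
- have {}zmin : U z <= U x by apply: zmin; exact: mem_set.
  (* Were all payoffs at [x] below [U z], so would be their maximum [U x], against the minimality of
     [U z]. *)
  apply: contrapT => h.
  have ltU a : u a x < U z.
    rewrite -subr_lt0 ltNge; apply/negP => ha; apply: h.
    by exists a; rewrite ?mem_index_enum.
  by move: zmin; apply/negP; rewrite -ltNge; apply/bigmax_ltP.
have wge x : dist R D x -> U z <= \sum_a w a * u a x.
  move=> dx; rewrite -subr_ge0; apply: le_trans (wz x dx) _.
  under eq_bigr do rewrite mulrBr.
  by rewrite sumrB -mulr_suml w1 mul1r.
have leU alpha : dist R A alpha -> \sum_a alpha a * u a z <= U z.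
  move=> [al0 al1]; rewrite -[leRHS]mul1r -al1 mulr_suml; apply: ler_sum => a _.
  exact: ler_wpM2l.
have dw : dist R A w by [].
(* Both inequalities pass through the value [U z]: no mixed attack exceeds it against [z], and [w]
   guarantees it against every defence. *)
exists z, w; split=> // delta alpha dd da; split.
  by apply: le_trans (leU _ da) (wge _ dz).
by apply: le_trans (leU _ dw) (wge _ dd).
Qed.

(** * Convexity and continuity of the utility of a pure attack *)

Section PureUtility.
Context {R : realType} {X Y D A : finType} (G : qif_game R X Y D A).
Context {p : X -> R} (hp : dist R X p).
Implicit Type delta : D -> R.

Let u a delta :=
  posterior_vulnerability (game_measure G) p (mixed_channel G delta a).

Lemma mixed_joint_ge0 a delta x y : dist R D delta ->
  0 <= joint p (mixed_channel G delta a) x y.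
Proof.
move=> [d0 _]; rewrite mulr_ge0 ?hp.1 // sumr_ge0 // => d _.
have [C01 _] := game_channelP G d a.
by rewrite mulr_ge0 //; case/andP: (C01 x y).
Qed.

Lemma mixed_joint_conv a (t : R) (d e : D -> R^o) x y :
  joint p (mixed_channel G (t *: d + (1 - t) *: e) a) x y =
  t * joint p (mixed_channel G d a) x y +
  (1 - t) * joint p (mixed_channel G e a) x y.
Proof.
rewrite /joint /mixed_channel !mulr_sumr -big_split; apply: eq_bigr => i _ /=.
rewrite -[(t *: d + (1 - t) *: e) i]/(t * d i + (1 - t) * e i).
by ring.
Qed.

Lemma pure_utility_convex a :
  convex_on (dist R D : set (D -> R^o)) (u a).
Proof.
move=> t d e t01 dd de; split; first exact: dist_convex.
case/andP: (t01) => t0 t1.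
rewrite /u !posterior_vulnerabilityE !mulr_sumr -big_split /=.
(* Homogeneity moves the weights t and 1 - t inside the perspective, so that subadditivity applies
   output by output. *)
apply: ler_sum => y _; rewrite -!perspectiveZ ?subr_ge0 //.
under eq_fun do rewrite mixed_joint_conv.
apply: perspectiveD; first exact: game_measureP.
  by move=> x; rewrite mulr_ge0 // mixed_joint_ge0.
by move=> x; rewrite mulr_ge0 ?subr_ge0 // mixed_joint_ge0.
Qed.

Lemma pure_utility_continuous a :
  {within (dist R D : set {ptws D -> R}), continuous (u a : {ptws D -> R} -> R)}.
Proof.
have -> : u a = fun delta =>
    \sum_y perspective (game_measure G) (joint p (mixed_channel G delta a) ^~ y).
  by apply/funext => delta; exact: posterior_vulnerabilityE.
apply/subspace_continuousP => d dd.
apply: (@cvg_sumr _ _ _ _ _ _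
  (fun y d => perspective (game_measure G) (joint p (mixed_channel G d a) ^~ y))).
move=> y _; apply: cvg_perspective; first exact: game_measureP.
- by move=> x; exact: mixed_joint_ge0.
(* Nonnegativity of the joint is known only for [e] in the simplex, which holds eventually along the
   filter within it. *)
- by apply: filterS (withinT _ _) => e de x; exact: mixed_joint_ge0.
move=> x; apply: cvgM; first exact: cvg_cst.
apply: (@cvg_sumr _ _ _ _ _ _
  (fun i (e : D -> R) => e i * game_channel G i a x y)).
move=> i _; apply: cvgM; last exact: cvg_cst.
apply: cvg_within_filter.
exact: (@ptws_cvg_coord D R d i).
Qed.

End PureUtility.

Theorem corollary5 (R : realType) (X Y D A : finType)
    (G : qif_game R X Y D A) (p : X -> R) (hp : dist R X p) :
  exists (delta' : D -> R) (alpha' : A -> R),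
    [/\ dist R D delta', dist R A alpha' &
        forall (delta : D -> R) (alpha : A -> R),
          dist R D delta -> dist R A alpha ->
          utility G p delta' alpha <= utility G p delta' alpha' /\
          utility G p delta' alpha' <= utility G p delta alpha'].
Proof.
apply: (convex_game_saddle_point _ (defender_nonempty G) (attacker_nonempty G)).
  exact: pure_utility_convex.
exact: pure_utility_continuous.
Qed.
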